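(* Let $U$, $W_*$, $X$ be normed spaces, $G:U\times X\rightrightarrows W_*$, $J:U\to\mathbb{R}$ continuously differentiable, $R:X\to(-\infty,\infty]$, and let $S:X\rightrightarrows U$, $S(x)=\{u\in U\mid 0\in G(u,x)\}$. Suppose $\mathrm{Inf}_{J\circ S}+R$ is minimised at $\bar x\in X$. If $\partial_{|A}R(\bar x)\ne\emptyset$ for a set $A\subset X$, then $$0\in\widehat D^*S_A(\bar x|\bar u)(J'(\bar u))+\partial_{|A}R(\bar x)\quad\text{for all}\quad\bar u\in S^\sharp(\bar x).$$ If, in particular, $\mathrm{dom}\,R=X$ with $\partial_{|X}R(\bar x)\neq\emptyset$ (for example, if $R$ is Lipschitz continuously differentiable), then $$0\in\widehat D^*S(\bar x|\bar u)(J'(\bar u))+\partial_F R(\bar x)\quad\text{for all}\quad\bar u\in S^\sharp(\bar x).$$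
   Context: $\mathrm{Inf}_{J\circ S}(x)=\inf\{J(u)\mid u\in S(x)\}$ and $S^\sharp(x)=\{u\in S(x)\mid J(u)=\mathrm{Inf}_{J\circ S}(x)\}$. For $A\subset X$, $S_A(x)=S(x)$ if $x\in A$ and $S_A(x)=\emptyset$ otherwise. $\mathrm{dom}\,R=\{x\mid R(x)<\infty\}$. Fréchet subdifferential of $F:X\to(-\infty,\infty]$ at $x$ with $F(x)$ finite (empty if $F(x)=\infty$): $\partial_F F(x)=\{x^*\in X^*\mid \liminf_{\tilde x\to x}\frac{F(\tilde x)-F(x)-\langle x^*|\tilde x-x\rangle}{\|\tilde x-x\|}\ge 0\}$. $A$-lower subdifferential: $\partial_{|A}R(x)=\{x^*\in\partial_F R(x)\mid\limsup_{A\ni x^k\to x}\frac{R(x^k)-R(x)-\langle x^*|x^k-x\rangle}{\|x^k-x\|}\le0\}$. Fréchet coderivative of $F:X\rightrightarrows Y$ at $x$ for $y$ (membership $y\in F(x)$ is not required): for $y^*\in Y^*$, $$\widehat D^*F(x|y)(y^* )=\Bigl\{x^*\in X^*\Bigm| \limsup_{\tilde x\to x,\ F(\tilde x)\ni\tilde y\to y}\frac{\langle x^*|\tilde x-x\rangle-\langle y^*|\tilde y-y\rangle}{\|\tilde x-x\|+\|\tilde y-y\|}\le 0\Bigr\}.$$ *)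

(* Defs.v *)
From HB Require Import structures.
From mathcomp Require Import all_boot all_order all_algebra.
From mathcomp Require Import all_classical all_reals all_analysis.

Set Implicit Arguments.
Unset Strict Implicit.
Unset Printing Implicit Defensive.

Import Order.TTheory GRing.Theory Num.Theory.
Import numFieldNormedType.Exports.

Local Open Scope classical_set_scope.
Local Open Scope ring_scope.

(* The dual space X^* is represented as a subset of the function space
   X -> K^o, so that its addition is the pointwise one. *)
Definition dual (K : realType) (X : normedModType K) : set (X -> K^o) :=
  [set f : X -> K^o | linear f /\ continuous f].

Definition dual_norm (K : realType) (X : normedModType K) (f : X -> K^o) : K :=
  sup [set `|f x| | x in [set x : X | `|x| <= 1]].

Definition set_add (V : zmodType) (A B : set V) : set V :=
  [set a + b | a in A & b in B].

(* Continuity of u |-> 'd J u is with respect to the dual norm. *)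
Definition continuously_differentiable (K : realType) (U : normedModType K)
    (J : U -> K^o) : Prop :=
  (forall u, differentiable J u) /\
  (forall u, dual_norm ('d J v \- 'd J u) @[v --> u] --> (0 : K)).

Definition lipschitz_continuously_differentiable (K : realType)
    (X : normedModType K) (r : X -> K^o) : Prop :=
  (forall x, differentiable r x) /\
  exists L : K, forall x y, dual_norm ('d r x \- 'd r y) <= L * `|x - y|.

Definition solution_map (K : realType) (U W X : normedModType K)
    (G : U * X -> set W) (x : X) : set U :=
  [set u | G (u, x) 0].

Definition restrict_map (X U : Type) (S : X -> set U) (A : set X) (x : X) :
    set U :=
  if x \in A then S x else set0.

Definition Inf_value (K : realType) (U X : Type) (J : U -> K)
    (S : X -> set U) (x : X) : \bar K :=
  ereal_inf [set (J u)%:E | u in S x].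

Definition argmin_map (K : realType) (U X : Type) (J : U -> K)
    (S : X -> set U) (x : X) : set U :=
  [set u | S x u /\ (J u)%:E = Inf_value J S x].

Definition effective_domain (K : realType) (X : Type) (R : X -> \bar K) :
    set X :=
  [set x | (R x < +oo)%E].

(* The dual addition of \bar K satisfies -oo + +oo = +oo, the convention
   appropriate to minimisation: F + R is +oo outside the domain of R even where
   F is -oo. *)
Definition minimises_sum (K : realType) (X : Type) (F R : X -> \bar K)
    (xbar : X) : Prop :=
  forall x, (dual_adde (F xbar) (R xbar) <= dual_adde (F x) (R x))%E.

(* In the definitions below, the limits are over punctured neighbourhoods, so
   that the denominators are nonzero. As limits along a filter, a limsup over
   an eventually empty set is -oo, and a liminf +oo. *)

Definition difference_quotient (K : realType) (X : normedModType K)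
    (F : X -> \bar K) (x : X) (xs : X -> K^o) (z : X) : \bar K :=
  ((F z - F x - (xs (z - x))%:E) / `|z - x|%:E)%E.

Definition frechet_subdiff (K : realType) (X : normedModType K)
    (F : X -> \bar K) (x : X) : set (X -> K^o) :=
  [set xs | [/\ dual xs, F x \is a fin_num &
    (0 <= limf_einf (difference_quotient F x xs) x^')%E]].

Definition lower_subdiff (K : realType) (X : normedModType K)
    (A : set X) (R : X -> \bar K) (x : X) : set (X -> K^o) :=
  [set xs | frechet_subdiff R x xs /\
    (limf_esup (difference_quotient R x xs) (within A x^') <= 0)%E].

Definition frechet_coderivative (K : realType) (X Y : normedModType K)
    (F : X -> set Y) (x : X) (y : Y) (ys : Y -> K^o) : set (X -> K^o) :=
  [set xs | dual xs /\
    (limf_esup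
       (fun p : X * Y =>
          ((xs (p.1 - x) - ys (p.2 - y)) / (`|p.1 - x| + `|p.2 - y|))%:E)
       (within [set p : X * Y | F p.1 p.2] (dnbhs ((x, y) : X * Y)))
     <= 0)%E].

(* Main.v *)
(** Since [R] is finite at [xbar] and minimality compares values of
    [J u + R x], every solution [u] of [S x] with [x] in [A] satisfies
    [R xbar - R x <= J u - J ubar].  An element [xs] of the [A]-lower
    subdifferential bounds [R x - R xbar] from above by
    [xs (x - xbar) + o(|x - xbar|)] on [A], and differentiability bounds
    [J u - J ubar] from above by ['d J ubar (u - ubar) + o(|u - ubar|)]; adding
    the two shows that [- xs] belongs to the coderivative. *)
Require Import Defs.
From HB Require Import structures.
From mathcomp Require Import all_boot all_order all_algebra.
From mathcomp Require Import all_classical all_reals all_analysis.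
From mathcomp Require Import lra.

Import Order.TTheory GRing.Theory Num.Theory.
Import numFieldNormedType.Exports.

Local Open Scope classical_set_scope.
Local Open Scope ring_scope.

(** The limsup is an infimum, over the sets of [F], of suprema of [f]; the sublevel set of [f] at
    height [e] serves as such a set. [F] may be improper, as when [within] restricts to an
    eventually empty set. *)
Lemma limf_esup_le0P (K : realType) (T : choiceType) (Y : filteredType T)
    (f : Y -> \bar K) (F : set_system Y) : Filter F ->
  (limf_esup f F <= 0)%E <->
  (forall e : K, 0 < e -> \forall y \near F, (f y <= e%:E)%E).
Proof.
move=> FF; rewrite limf_esupE; split=> [f0 e e0|fe].
  have : (ereal_inf [set ereal_sup [set f x | x in V] | V in F] < e%:E)%E.
    by apply: le_lt_trans f0 _; rewrite lte_fin.
  move=> /ereal_inf_lt[_ [V FV <-]] Ve.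
  apply: filterS FV => y Vy; apply: le_trans (ltW Ve).
  by apply: ereal_sup_ubound; exists y.
apply/lee_addgt0Pr => e e0; rewrite add0e; apply: ge_ereal_inf.
exists (ereal_sup [set f x | x in [set y | (f y <= e%:E)%E]]).
  by exists [set y | (f y <= e%:E)%E] => //; exact: fe.
by apply: ge_ereal_sup => _ [y fy <-].
Qed.

Lemma limf_einf_ge0P (K : realType) (T : choiceType) (Y : filteredType T)
    (f : Y -> \bar K) (F : set_system Y) : Filter F ->
  (0 <= limf_einf f F)%E <->
  (forall e : K, 0 < e -> \forall y \near F, ((- e)%:E <= f y)%E).
Proof.
move=> FF; rewrite /limf_einf oppe_ge0 limf_esup_le0P.
by split=> h e e0; apply: filterS (h _ e0) => y; rewrite EFinN leeNl.
Qed.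

Lemma dualN (K : realType) (X : normedModType K) (xs : X -> K^o) :
  dual xs -> dual (- xs).
Proof.
move=> [xsl xsc]; split=> [a x y|x]; last exact: (continuousN (xsc x)).
by rewrite !fctE xsl opprD scalerN.
Qed.

Lemma dual_diff (K : realType) (X : normedModType K) (f : X -> K^o) (x : X) :
  differentiable f x -> dual ('d f x).
Proof.
by move=> dfx; split; [exact: linearP | exact: diff_continuous].
Qed.

Lemma differentiable_near (K : realType) (X : normedModType K) (f : X -> K^o)
    (x : X) (e : K) : differentiable f x -> 0 < e ->
  \forall y \near x, `|f y - f x - 'd f x (y - x)| <= e * `|y - x|.
Proof.
move=> /diff_locally/eqaddoP/(_ e)/[apply].
rewrite [X in _ -> X](near_shift 0) subr0; apply: filterS => h /=.
by rewrite !fctE /= addrK opprD addrA.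
Qed.

(** Clearing the denominator gives a bound that also holds at [z = x]. This matters in the product
    space, where punctured neighbourhoods of [(xbar, ubar)] contain points [(xbar, u)]. *)
Lemma lower_subdiff_near (K : realType) (X : normedModType K) (A : set X)
    (R : X -> \bar K) (x : X) (xs : X -> K^o) (e : K) :
  lower_subdiff A R x xs -> 0 < e ->
  \forall z \near x, A z -> (R z <= R x + (xs (z - x) + e * `|z - x|)%:E)%E.
Proof.
move=> [[[xsl _] Rx _] /limf_esup_le0P Rle] e0.
have xs0 : xs 0 = 0.
  by have := xsl (-1) 0 0; rewrite scaleN1r oppr0 addr0 scaleN1r addNr.
have := Rle _ e0; rewrite !near_withinE; apply: filterS => z zle Az.
have [->|zx] := eqVneq z x.
  by rewrite subrr xs0 normr0 mulr0 addr0 adde0.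
have := zle zx Az; have dzx : 0 < `|z - x| by rewrite normr_gt0 subr_eq0.
rewrite /difference_quotient inver gt_eqF// lee_pdivrMr//.
case: (R x) Rx => // r _; case: (R z) => [s| |]//=.
  by rewrite -!EFinB -!EFinM -!EFinD !lee_fin; lra.
by move=> _; rewrite leNye.
Qed.

Lemma minimises_sum_argmin (K : realType) (U X : Type) (J : U -> K)
    (S : X -> set U) (R : X -> \bar K) (xbar x : X) (ubar u : U) (s r : K) :
  minimises_sum (Inf_value J S) R xbar -> argmin_map J S xbar ubar ->
  S x u -> R xbar = r%:E -> R x = s%:E -> J ubar + r <= J u + s.
Proof.
move=> hmin [_ Jubar] Sxu Rxbar Rx.
have InfJu : (Inf_value J S x <= (J u)%:E)%E.
  by apply: ereal_inf_lbound; exists u.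
have := hmin x; rewrite -Jubar Rxbar Rx; move: InfJu.
(* The value [+oo] is excluded since [u] competes in the infimum, and [-oo] since minimality bounds
   the sum below by the finite [J ubar + r]. *)
case: (Inf_value J S x) => [a| |] //; rewrite /dual_adde/= !lee_fin => aJu.
by move=> /le_trans; apply; rewrite lerD2r.
Qed.

Lemma coderivative_lower_subdiff (K : realType) (U X : normedModType K)
    (J : U -> K^o) (S : X -> set U) (R : X -> \bar K) (A : set X)
    (xbar : X) (ubar : U) (xs : X -> K^o) :
  differentiable J ubar -> (forall x, (-oo < R x)%E) ->
  minimises_sum (Inf_value J S) R xbar -> argmin_map J S xbar ubar ->
  lower_subdiff A R xbar xs ->
  frechet_coderivative (restrict_map S A) xbar ubar ('d J ubar) (- xs).
Proof.
move=> dJ hR hmin hubar hxs; have [[dxs Rxbar _] _] := hxs.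
split; first exact: dualN.
apply/limf_esup_le0P => e e0.
have nearR := lower_subdiff_near K X A R xbar xs e hxs e0.
have nearJ := differentiable_near K U J ubar e dJ e0.
rewrite !near_withinE.
(* With the same [e] in both bounds, the errors add up to [e] times the denominator of the
   coderivative quotient. *)
have : \forall p \near ((xbar, ubar) : X * U),
    (A p.1 -> (R p.1 <= R xbar + (xs (p.1 - xbar) + e * `|p.1 - xbar|)%:E)%E) /\
    `|J p.2 - J ubar - 'd J ubar (p.2 - ubar)| <= e * `|p.2 - ubar|.
  by apply: filterI; [exact: (cvg_fst nearR) | exact: (cvg_snd nearJ)].
apply: filterS => -[x u] /= [Rx Ju] _; rewrite /restrict_map.
case: ifPn => // /set_mem Ax Sxu; rewrite lee_fin.
have d0 : 0 <= `|x - xbar| + `|u - ubar| by rewrite addr_ge0.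
have {Rx} := Rx Ax; have Rxy := hR x.
(* [R x] is finite: [hR] excludes [-oo], and the upper bound on [A] excludes [+oo]. *)
move: Rxbar Rxy (minimises_sum_argmin K U X J S R xbar x ubar u).
case: (R xbar) => // r _; case: (R x) => // s _ /(_ s r hmin hubar Sxu).
move=> /(_ erefl erefl) Jmin; rewrite -EFinD lee_fin => Rx.
(* At the base point itself the quotient is [0], by the convention that the inverse of [0] is
   [0]. *)
have [->|dn0] := eqVneq (`|x - xbar| + `|u - ubar|) 0.
  by rewrite invr0 mulr0 ltW.
rewrite ler_pdivrMr ?lt_def ?dn0// fctE.
by move: Ju; rewrite ler_norml => /andP[_ Ju]; lra.
Qed.

(** The difference quotient tends to [0], so one two-sided bound gives both the liminf and the
    limsup condition, for every [A]. *)
Lemma differentiable_lower_subdiff (K : realType) (X : normedModType K)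
    (r : X -> K^o) (x : X) (A : set X) : differentiable r x ->
  lower_subdiff A (fun y => (r y)%:E) x ('d r x).
Proof.
move=> dr.
have quotient_near (e : K) : 0 < e -> \forall y \near x, y != x ->
    exists2 q : K, difference_quotient (fun y => (r y)%:E) x ('d r x) y = q%:E &
      `|q| <= e.
  move=> e0; have := differentiable_near K X r x e dr e0.
  apply: filterS => y ry yx.
  have dyx : 0 < `|y - x| by rewrite normr_gt0 subr_eq0.
  exists ((r y - r x - 'd r x (y - x)) / `|y - x|).
    by rewrite /difference_quotient inver gt_eqF.
  by rewrite normrM normfV normr_id ler_pdivrMr.
split; first split => //; first exact: dual_diff.
  apply/limf_einf_ge0P => e /quotient_near; rewrite near_withinE.
  apply: filterS => y /[apply] -[q -> ].
  by rewrite lee_fin ler_norml => /andP[].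
apply/limf_esup_le0P => e /quotient_near; rewrite !near_withinE.
apply: filterS => y /[apply] -[q -> ].
by rewrite lee_fin ler_norml => /andP[].
Qed.

Theorem theorem3p1 (K : realType) (U W X : normedModType K)
    (G : U * X -> set W) (J : U -> K^o) (R : X -> \bar K) (xbar : X)
    (hJ : continuously_differentiable J)
    (hR : forall x, (-oo < R x)%E)
    (hmin : minimises_sum (Inf_value J (solution_map G)) R xbar) :
  (forall A : set X, lower_subdiff A R xbar !=set0 ->
    forall ubar : U, argmin_map J (solution_map G) xbar ubar ->
      set_add
        (frechet_coderivative (restrict_map (solution_map G) A)
           xbar ubar ('d J ubar))
        (lower_subdiff A R xbar) 0) /\
  (effective_domain R = setT -> lower_subdiff setT R xbar !=set0 ->
    forall ubar : U, argmin_map J (solution_map G) xbar ubar ->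
      set_add
        (frechet_coderivative (solution_map G) xbar ubar ('d J ubar))
        (frechet_subdiff R xbar) 0) /\
  (forall r : X -> K^o, lipschitz_continuously_differentiable r ->
    (forall x, R x = (r x)%:E) ->
    effective_domain R = setT /\ lower_subdiff setT R xbar !=set0).
Proof.
have coder A xs ubar : lower_subdiff A R xbar xs ->
    argmin_map J (solution_map G) xbar ubar ->
    frechet_coderivative (restrict_map (solution_map G) A) xbar ubar
      ('d J ubar) (- xs).
  by move=> hxs hubar; apply: coderivative_lower_subdiff hxs => //; case: hJ.
split=> [A [xs hxs] ubar hubar|]; last split.
- by exists (- xs); [exact: coder | exists xs; rewrite // addNr].
(* This is the case of the whole space: restricting to it leaves the solution map unchanged, and a
   lower subgradient is a Fréchet subgradient. *)
- move=> _ [xs hxs] ubar hubar; exists (- xs); last first.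
    by exists xs; [case: hxs | rewrite addNr].
  have := coder setT xs ubar hxs hubar.
  have -> // : restrict_map (solution_map G) setT = solution_map G.
  by apply/funext => x; rewrite /restrict_map in_setT.
- move=> r [dr _] Rr; have -> : R = (fun x => (r x)%:E) by exact/funext.
  split; first by apply/seteqP; split=> // x _; rewrite /effective_domain/= ltry.
  by exists ('d r xbar); exact: differentiable_lower_subdiff.
Qed.
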